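(* Let $G$ be a group generated by a finite set $S\subset G$ which is invariant under conjugation (i.e. $gSg^{-1}=S$ for all $g\in G$). Then $G$ is quasi-isometric to $\mathbb{Z}^n$, where $n=\mathrm{rk}(G^{ab})$ is the rank (the dimension of $G^{ab}\otimes\mathbb{Q}$) of the abelianisation $G^{ab}=G/[G,G]$.
   Context: Finitely generated groups are regarded as metric spaces via the word metric of any finite generating set (unique up to quasi-isometry). A map $f:(X,d)\to(X',d')$ of metric spaces is a quasi-isometry if there are constants $A\ge1$, $B,C\ge0$ with $\frac1A d(x,y)-B\le d'(f(x),f(y))\le A d(x,y)+B$ for all $x,y\in X$, and every point of $X'$ is within distance $C$ of $f(X)$. *)

(* Defs.v *)
From HB Require Import structures.
From mathcomp Require Import all_boot all_order all_algebra.
From mathcomp Require Import boolp classical_sets cardinality reals.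

Set Implicit Arguments.
Unset Strict Implicit.
Unset Printing Implicit Defensive.

Import Order.TTheory GRing.Theory Num.Theory.

Local Open Scope classical_set_scope.
Local Open Scope quotient_scope.

(* Groups are MathComp's (possibly infinite) [groupType]s. *)

Section Generation.
Local Open Scope group_scope.
Variable G : groupType.
Implicit Types (S : set G) (w : seq G) (x y g : G).

(* [w] is a word in the letters S and S^-1. *)
Definition is_word S w := forall s, s \in w -> S s \/ S s^-1.

Definition generated_subgroup S : set G :=
  [set \prod_(s <- w) s | w in is_word S].

Definition generating S := generated_subgroup S = setT.

Definition finitely_generated := exists2 S, finite_set S & generating S.

Definition conj_invariant S := forall g, [set g * s * g^-1 | s in S] = S.

Definition derived_subgroup : set G :=
  generated_subgroup [set [~ x, y] | x in setT & y in setT].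

End Generation.
Arguments finitely_generated : clear implicits.
Arguments derived_subgroup : clear implicits.

(* The least length of a word in S and S^-1 representing x^-1 y. *)
Definition word_dist (R : realType) (G : groupType) (S : set G) (x y : G) : R :=
  inf [set (size w)%:R%R | w in
        [set w : seq G | is_word S w /\ (\prod_(s <- w) s = x^-1 * y)%g]].
Arguments word_dist R {G} S x y.

Section QuasiIsometry.
Local Open Scope ring_scope.
Variable R : realType.

Definition is_quasi_isometry (X X' : Type) (d : X -> X -> R)
    (d' : X' -> X' -> R) (f : X -> X') :=
  exists A B C : R,
    [/\ [/\ 1 <= A, 0 <= B & 0 <= C],
        forall x y, A^-1 * d x y - B <= d' (f x) (f y) <= A * d x y + B
      & forall x', exists x, d' x' (f x) <= C].

Definition quasi_isometric (X X' : Type) (d : X -> X -> R)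
  (d' : X' -> X' -> R) := exists f, is_quasi_isometry d d' f.

Definition quasi_isometric_groups (G H : groupType) :=
  [/\ finitely_generated G, finitely_generated H
    & forall (S : set G) (T : set H),
        finite_set S -> generating S -> finite_set T -> generating T ->
        quasi_isometric (word_dist R S) (word_dist R T)].

End QuasiIsometry.

Definition Zn (n : nat) : groupType := Algebra.to_multiplicative 'rV[int]_n.

Section GeneratedSubgroupTheory.
Local Open Scope group_scope.
Variables (G : groupType) (S : set G).

Lemma generated_subgroup1 : generated_subgroup S 1.
Proof. by exists [::]; rewrite ?big_nil. Qed.

Lemma sub_generated_subgroup : S `<=` generated_subgroup S.
Proof.
move=> s Ss; exists [:: s]; last by rewrite big_seq1.
by move=> t; rewrite inE => /eqP->; left.
Qed.

Lemma generated_subgroupM x y : generated_subgroup S x ->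
  generated_subgroup S y -> generated_subgroup S (x * y).
Proof.
move=> [u wu <-] [v wv <-]; exists (u ++ v); last by rewrite big_cat.
by move=> s; rewrite mem_cat => /orP[/wu|/wv].
Qed.

Lemma generated_subgroupV x :
  generated_subgroup S x -> generated_subgroup S x^-1.
Proof.
move=> [w + <-]; elim: w => [_|s w IHw ww].
  by rewrite big_nil invg1; apply: generated_subgroup1.
rewrite big_cons invgM; apply: generated_subgroupM.
  by apply: IHw => t tw; apply: ww; rewrite inE tw orbT.
exists [:: s^-1]; last by rewrite big_seq1.
move=> t; rewrite inE => /eqP->; rewrite invgK.
by have [|Ss|Ss] := ww s; [rewrite mem_head | right | left].
Qed.

End GeneratedSubgroupTheory.

Section DerivedSubgroupTheory.
Local Open Scope group_scope.
Variable G : groupType.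

Lemma derived_commg (x y : G) : derived_subgroup G [~ x, y].
Proof. by apply: sub_generated_subgroup; exists x => //; exists y. Qed.

Lemma derivedJ (x y : G) : derived_subgroup G x -> derived_subgroup G (x ^ y).
Proof.
move=> Dx; have -> : x ^ y = x * [~ x, y] by rewrite /commg mulVKg.
by apply: generated_subgroupM => //; apply: derived_commg.
Qed.

End DerivedSubgroupTheory.

(* G^ab = G/[G,G], written additively. *)
Section Abelianization.
Local Open Scope group_scope.
Variable G : groupType.

Definition ab_rel (x y : G) : bool := `[< derived_subgroup G (x^-1 * y) >].

Lemma ab_rel_equiv : equiv_class_of ab_rel.
Proof.
split=> [x|x y|y x z].
- by apply/asboolP; rewrite mulVg; apply: generated_subgroup1.
- by apply/asboolP/asboolP => /generated_subgroupV; rewrite invgM invgK.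
- move=> /asboolP xy /asboolP yz; apply/asboolP.
  by have := generated_subgroupM xy yz; rewrite mulgA mulgK.
Qed.

Canonical ab_equiv := EquivRelPack ab_rel_equiv.

Definition abelianization := {eq_quot ab_equiv}.
HB.instance Definition _ := Choice.on abelianization.
HB.instance Definition _ := EqQuotient.on abelianization.

Definition ab_pi (x : G) : abelianization := \pi x.

Lemma ab_piP x y : reflect (ab_pi x = ab_pi y) `[< derived_subgroup G (x^-1 * y) >].
Proof. by apply: (iffP idP) => [h|]; [apply/eqmodP | move/eqmodP]. Qed.

Lemma ab_pi_repr (a : abelianization) : ab_pi (repr a) = a.
Proof. exact: reprK. Qed.

Definition ab_add (a b : abelianization) := ab_pi (repr a * repr b).
Definition ab_opp (a : abelianization) := ab_pi (repr a)^-1.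

Lemma ab_piC x y : ab_pi (x * y) = ab_pi (y * x).
Proof.
apply/ab_piP/asboolP.
by have := derived_commg y x; rewrite /commg /conjg invgM !mulgA.
Qed.

Lemma ab_pi_mul x x' y y' : ab_pi x = ab_pi x' -> ab_pi y = ab_pi y' ->
  ab_pi (x * y) = ab_pi (x' * y').
Proof.
move=> /ab_piP/asboolP xx' /ab_piP/asboolP yy'; apply/ab_piP/asboolP.
have := generated_subgroupM (derivedJ y xx') yy'.
by rewrite /conjg invgM !mulgA mulgK.
Qed.

Lemma ab_addE x y : ab_add (ab_pi x) (ab_pi y) = ab_pi (x * y).
Proof. by apply: ab_pi_mul; apply: ab_pi_repr. Qed.

Lemma ab_addA : associative ab_add.
Proof.
move=> a b c; rewrite -(ab_pi_repr a) -(ab_pi_repr b) -(ab_pi_repr c).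
by rewrite !ab_addE mulgA.
Qed.

Lemma ab_addC : commutative ab_add.
Proof. by move=> a b; apply: ab_piC. Qed.

Lemma ab_add0 : left_id (ab_pi 1) ab_add.
Proof. by move=> a; rewrite -(ab_pi_repr a) ab_addE mul1g. Qed.

Lemma ab_addN : left_inverse (ab_pi 1) ab_opp ab_add.
Proof. by move=> a; rewrite -{2}(ab_pi_repr a) ab_addE mulVg. Qed.

HB.instance Definition _ :=
  GRing.isZmodule.Build abelianization ab_addA ab_addC ab_add0 ab_addN.

End Abelianization.

(* A (x)_Z Q: formal sums of pure tensors a (x) q, encoded as sequences of
   pairs (a, q), modulo the least congruence making (x) biadditive. This
   quotient of the free commutative monoid on A x Q is already a group,
   since (- a) (x) q is opposite to a (x) q. *)
Section TensorQ.
Local Open Scope ring_scope.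
Variable A : zmodType.
Implicit Types (a b : A) (q r : rat) (s t u v : seq (A * rat)).

Inductive tensorQ_cong : seq (A * rat) -> seq (A * rat) -> Prop :=
| tensorQ_refl s : tensorQ_cong s s
| tensorQ_sym s t : tensorQ_cong s t -> tensorQ_cong t s
| tensorQ_trans s t u :
    tensorQ_cong s t -> tensorQ_cong t u -> tensorQ_cong s u
| tensorQ_cat s s' t t' : tensorQ_cong s s' -> tensorQ_cong t t' ->
    tensorQ_cong (s ++ t) (s' ++ t')
| tensorQ_catC s t : tensorQ_cong (s ++ t) (t ++ s)
| tensorQ_0l q : tensorQ_cong [:: (0, q)] [::]
| tensorQ_0r a : tensorQ_cong [:: (a, 0)] [::]
| tensorQ_Dl a b q : tensorQ_cong [:: (a + b, q)] [:: (a, q); (b, q)]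
| tensorQ_Dr a q r : tensorQ_cong [:: (a, q + r)] [:: (a, q); (a, r)].

Definition tensorQ_rel s t : bool := `[< tensorQ_cong s t >].

Lemma tensorQ_rel_equiv : equiv_class_of tensorQ_rel.
Proof.
split=> [s|s t|t s u]; first by apply/asboolP/tensorQ_refl.
  by apply/asboolP/asboolP; apply: tensorQ_sym.
by move=> /asboolP st /asboolP tu; apply/asboolP/(tensorQ_trans st tu).
Qed.

Canonical tensorQ_equiv := EquivRelPack tensorQ_rel_equiv.

Definition tensorQ := {eq_quot tensorQ_equiv}.
HB.instance Definition _ := Choice.on tensorQ.
HB.instance Definition _ := EqQuotient.on tensorQ.

Definition tensorQ_pi s : tensorQ := \pi s.

Lemma tensorQ_piP s t :
  reflect (tensorQ_pi s = tensorQ_pi t) `[< tensorQ_cong s t >].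
Proof. by apply: (iffP idP) => [h|]; [apply/eqmodP | move/eqmodP]. Qed.

Lemma tensorQ_pi_repr (x : tensorQ) : tensorQ_pi (repr x) = x.
Proof. exact: reprK. Qed.

Lemma tensorQ_cong_repr s : tensorQ_cong (repr (tensorQ_pi s)) s.
Proof. exact/asboolP/tensorQ_piP/tensorQ_pi_repr. Qed.

Definition tensorQ_add (x y : tensorQ) := tensorQ_pi (repr x ++ repr y).
Definition tensorQ_opp (x : tensorQ) :=
  tensorQ_pi [seq (- p.1, p.2) | p <- repr x].
Definition tensorQ_scale q (x : tensorQ) :=
  tensorQ_pi [seq (p.1, q * p.2) | p <- repr x].

Lemma tensorQ_addE s t :
  tensorQ_add (tensorQ_pi s) (tensorQ_pi t) = tensorQ_pi (s ++ t).
Proof.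
by apply/tensorQ_piP/asboolP/tensorQ_cat; apply: tensorQ_cong_repr.
Qed.

Lemma tensorQ_cong_scale q s t : tensorQ_cong s t ->
  tensorQ_cong [seq (p.1, q * p.2) | p <- s] [seq (p.1, q * p.2) | p <- t].
Proof.
elim=> {s t} /=.
- by move=> s; apply: tensorQ_refl.
- by move=> s t _; apply: tensorQ_sym.
- by move=> s t u _ st _ tu; apply: tensorQ_trans st tu.
- by move=> s s' t t' _ ss' _ tt'; rewrite !map_cat; apply: tensorQ_cat.
- by move=> s t; rewrite !map_cat; apply: tensorQ_catC.
- by move=> r; apply: tensorQ_0l.
- by move=> a; rewrite mulr0; apply: tensorQ_0r.
- by move=> a b r; apply: tensorQ_Dl.
- by move=> a r r'; rewrite mulrDr; apply: tensorQ_Dr.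
Qed.

Lemma tensorQ_scaleE q s : tensorQ_scale q (tensorQ_pi s) =
  tensorQ_pi [seq (p.1, q * p.2) | p <- s].
Proof.
exact/tensorQ_piP/asboolP/tensorQ_cong_scale/tensorQ_cong_repr.
Qed.

Lemma tensorQ_addA : associative tensorQ_add.
Proof.
move=> x y z.
rewrite -(tensorQ_pi_repr x) -(tensorQ_pi_repr y) -(tensorQ_pi_repr z).
by rewrite !tensorQ_addE catA.
Qed.

Lemma tensorQ_addC : commutative tensorQ_add.
Proof. by move=> x y; apply/tensorQ_piP/asboolP/tensorQ_catC. Qed.

Lemma tensorQ_add0 : left_id (tensorQ_pi [::]) tensorQ_add.
Proof. by move=> x; rewrite -(tensorQ_pi_repr x) tensorQ_addE. Qed.

Lemma tensorQ_addN : left_inverse (tensorQ_pi [::]) tensorQ_opp tensorQ_add.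
Proof.
move=> x; rewrite -{2}(tensorQ_pi_repr x) tensorQ_addE.
elim: (repr x) => //= -[a q] s IHs.
transitivity (tensorQ_pi ([:: (- a, q); (a, q)] ++
                          ([seq (- p.1, p.2) | p <- s] ++ s))).
  apply/tensorQ_piP/asboolP.
  apply: (tensorQ_cat (tensorQ_refl [:: (- a, q)])).
  rewrite -cat1s -(cat1s (a, q) (_ ++ _)) !catA.
  by apply: tensorQ_cat (tensorQ_catC _ _) (tensorQ_refl _).
rewrite -tensorQ_addE IHs tensorQ_addC tensorQ_add0.
apply/tensorQ_piP/asboolP/(tensorQ_trans _ (tensorQ_0l q)).
by apply: tensorQ_sym; rewrite -[X in [:: (X, q)]](addNr a); apply: tensorQ_Dl.
Qed.

HB.instance Definition _ := GRing.isZmodule.Build tensorQ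
  tensorQ_addA tensorQ_addC tensorQ_add0 tensorQ_addN.

Lemma tensorQ_scaleA q r x :
  tensorQ_scale q (tensorQ_scale r x) = tensorQ_scale (q * r) x.
Proof.
rewrite -(tensorQ_pi_repr x) !tensorQ_scaleE -map_comp.
by congr tensorQ_pi; apply: eq_map => p /=; rewrite mulrA.
Qed.

Lemma tensorQ_scale1 : left_id 1 tensorQ_scale.
Proof.
move=> x; rewrite -[RHS]tensorQ_pi_repr; congr tensorQ_pi.
by rewrite -[RHS]map_id; apply: eq_map => -[a q] /=; rewrite mul1r.
Qed.

Lemma tensorQ_scaleDr : right_distributive tensorQ_scale +%R.
Proof.
move=> q x y; rewrite -(tensorQ_pi_repr x) -(tensorQ_pi_repr y).
have addE s t : tensorQ_pi s + tensorQ_pi t = tensorQ_pi (s ++ t).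
  exact: tensorQ_addE.
by rewrite addE !tensorQ_scaleE map_cat addE.
Qed.

Lemma tensorQ_scaleDl x : {morph tensorQ_scale^~ x : q r / q + r}.
Proof.
move=> q r; rewrite -(tensorQ_pi_repr x) !tensorQ_scaleE.
have addE s t : tensorQ_pi s + tensorQ_pi t = tensorQ_pi (s ++ t).
  exact: tensorQ_addE.
elim: (repr x) => [|[a p] s IHs] /=; first by rewrite addE.
rewrite -cat1s -[in RHS]cat1s -[(a, r * p) :: _]cat1s -!addE IHs.
have -> : tensorQ_pi [:: (a, (q + r) * p)] =
          tensorQ_pi [:: (a, q * p)] + tensorQ_pi [:: (a, r * p)].
  rewrite mulrDl addE.
  by apply/tensorQ_piP/asboolP/tensorQ_Dr.
exact: addrACA.
Qed.

HB.instance Definition _ := GRing.Zmodule_isLmodule.Build rat tensorQ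
  tensorQ_scaleA tensorQ_scale1 tensorQ_scaleDr tensorQ_scaleDl.

End TensorQ.

Section Rank.
Local Open Scope ring_scope.

Definition is_basis (F : fieldType) (V : lmodType F) n (e : 'I_n -> V) :=
  forall v, exists! c : 'rV[F]_n, v = \sum_(i < n) c 0 i *: e i.

Definition has_dimension (F : fieldType) (V : lmodType F) (n : nat) :=
  exists e : 'I_n -> V, is_basis e.

Lemma has_dimension_uniq (F : fieldType) (V : lmodType F) m n :
  has_dimension V m -> has_dimension V n -> m = n.
Proof.
wlog suff: m n / has_dimension V m -> has_dimension V n -> (m <= n)%N.
  move=> le Vm Vn; apply/eqP; rewrite eqn_leq.
  by rewrite (le _ _ Vm Vn) (le _ _ Vn Vm).
move=> [e eB] [f fB].
pose A := \matrix_i sval (cid (fB (e i))).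
have eE i : e i = \sum_j A i j *: f j.
  rewrite {1}(svalP (cid (fB (e i)))).1.
  by apply: eq_bigr => j _; rewrite mxE.
suff : row_free A by move/eqP <-; apply: rank_leq_col.
apply/row_freeP; apply: contrapT => nA.
have : ~~ row_free A by apply/negP => /row_freeP.
rewrite -kermx_eq0 => /rowV0Pn[c /sub_kermxP cA /negP]; apply; apply/eqP.
have [c0 [_ c0U]] := eB 0.
rewrite -(c0U c) ?(c0U 0) //; first by rewrite big1 // => i _; rewrite mxE scale0r.
under eq_bigr do rewrite eE scaler_sumr.
rewrite exchange_big big1 //= => j _.
under eq_bigr do rewrite scalerA.
have := congr1 (fun M : 'rV_n => M 0 j) cA.
by rewrite -scaler_suml !mxE => ->; rewrite scale0r.
Qed.

(* rk(A) = dim_Q (A (x) Q); at most one such n by [has_dimension_uniq]. *)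
Definition has_rank (A : zmodType) (n : nat) := has_dimension (tensorQ A) n.

End Rank.

(* Main.v *)
Require Import Defs.
From mathcomp Require Import fingroup perm cyclic.
From mathcomp Require Import all_boot all_order all_algebra.
From mathcomp Require Import boolp classical_sets cardinality reals.
From mathcomp Require Import zify ring.

(* Since S is finite and invariant under conjugation, a fixed power s^m of
   every generator is central, and it depends only on the conjugacy class of s.
   In a long word some letter s occurs m times; moving these occurrences to the
   front only conjugates the other letters, and splits off the central element
   s^m. Hence every element is a product of powers of the central elements s^m
   and of a word of bounded length. An element of [G,G] is the value of a word
   whose exponent sum over each class vanishes, so the powers are determined by
   the bounded word: [G,G] is finite. The coordinates of m'a, for a in G^ab, in
   a maximal independent family of generators of G^ab then give a homomorphism
   from G to Z^n with finite kernel and image of finite index, which is a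
   quasi-isometry. *)

Set Implicit Arguments.
Unset Strict Implicit.
Unset Printing Implicit Defensive.

Import Order.TTheory GRing.Theory Num.Theory.

Local Open Scope classical_set_scope.

(** * Finiteness of the derived subgroup *)

Lemma finite_bounded_words (T : eqType) (s : seq T) n :
  finite_set [set u : seq T | all (mem s) u /\ size u <= n].
Proof.
elim: n => [|n IHn].
  apply: (@sub_finite_set _ _ [set [::]]); last exact: finite_set1.
  by move=> u /= [_]; rewrite leqn0 size_eq0 => /eqP.
pose W := [set u : seq T | all (mem s) u /\ size u <= n].
apply: (@sub_finite_set _ _
  ([set [::]] `|` [set x :: u | x in [set` s] & u in W])).
  move=> [|x u] /= [us nu]; first by left.
  by right; case/andP: us => xs us; exists x => //; exists u.
rewrite finite_setU; split; first exact: finite_set1.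
by apply: finite_image2 => //; apply: finite_seq.
Qed.

(** Repeated entries of [s] are counted several times on the right, whence only an inequality. *)
Lemma leq_size_sum_count (T : eqType) (s w : seq T) :
  all (mem s) w -> size w <= \sum_(t <- s) count_mem t w.
Proof.
elim: w => //= x w IHw /andP[xs /IHw le]; rewrite big_split /= -add1n.
apply: leq_add => //.
have -> : \sum_(t <- s) (x == t) = count_mem x s.
  rewrite -sum1_count [RHS]big_mkcond /=; apply: eq_bigr => t _.
  by rewrite eq_sym; case: eqP.
by rewrite -has_count has_pred1.
Qed.

Lemma pigeonhole_count (T : eqType) (s w : seq T) m :
  all (mem s) w -> size s * m < size w ->
  exists2 t, t \in s & m < count_mem t w.
Proof.
move=> /leq_size_sum_count sw lt; apply/hasP; apply: contraLR lt.
rewrite -all_predC -leqNgt => /allP le; apply: leq_trans sw _.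
rewrite mulnC -iter_addn_0 -count_predT -big_const_seq big_seq [leqRHS]big_seq.
by apply: leq_sum => t /le; rewrite /= -leqNgt.
Qed.

Section Groups.
Local Open Scope group_scope.
Variable G : groupType.
Implicit Types (S : set G) (x y z g t : G) (s u w : seq G).

Lemma generated_subgroup_ind S (P : G -> Prop) :
    P 1 -> (forall x y, P x -> P y -> P (x * y)) ->
    (forall x, P x -> P x^-1) -> (forall x, S x -> P x) ->
  forall x, generated_subgroup S x -> P x.
Proof.
move=> P1 PM PV PS _ [w + <-]; elim: w => [|x w IHw] ww.
  by rewrite big_nil.
rewrite big_cons; apply: PM; last first.
  by apply: IHw => t tw; apply: ww; rewrite inE tw orbT.
have [|/PS//|/PS/PV] := ww x; first by rewrite mem_head.
by rewrite invgK.
Qed.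

(* Conjugation by [x] permutes the finite set [s], so [m] can be taken to be
   the order of the symmetric group of [s]. *)
Lemma exponent_central s :
    (forall x y, x \in s -> x ^ y \in s) -> generating [set` s] ->
  exists2 m, (0 < m)%N & forall x y, x \in s -> commute (x ^+ m) y.
Proof.
move=> sJ gens.
pose T := seq_sub s; pose N := #|[set: {perm T}]%SET|.
exists N; first exact: cardG_gt0.
move=> x y xs.
have conjT (t : T) : ssval t ^ x \in s by apply/sJ/ssvalP.
pose f (t : T) : T := SeqSub (conjT t).
have finj : injective f.
  by move=> t t' /(congr1 (@ssval _ _)) /= /conjg_inj /val_inj.
have fN (t : T) : iter N f t = t.
  have : perm finj ^+ N = 1 by apply: expg_cardG; rewrite inE.
  move=> /perm.permP/(_ t); rewrite permX perm1 => {2}<-.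
  by apply: eq_iter => u; rewrite permE.
have iterE k (t : T) : ssval (iter k f t) = ssval t ^ (x ^+ k).
  by elim: k => [|k IHk]; rewrite ?conjg1 //= IHk -conjgM -expgSr.
(* The elements commuting with [x ^+ N] form a subgroup, so [y] may be taken in [s], where
   conjugation by [x ^+ N] is the identity. *)
have : generated_subgroup [set` s] y by rewrite gens.
apply: generated_subgroup_ind => {y} [|y z cy cz|y cy|y ys].
- exact: commute1.
- exact: commuteM.
- exact: commuteV.
- apply/commute_sym/commgP; rewrite -conjg_fix; apply/eqP.
  by have := iterE N (SeqSub ys); rewrite fN.
Qed.

(* Moving a letter [t] to the front of a word conjugates by [t] the letters it
   jumps over. *)
Lemma pull_letter t w : t \in w -> exists w',
  \prod_(x <- w) x = t * \prod_(x <- w') x /\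
  forall p : pred G, (forall x, p (x ^ t) = p x) ->
    count p w = (p t + count p w')%N.
Proof.
move=> /splitPr[w1 w2]; exists ([seq x ^ t | x <- w1] ++ w2); split.
  rewrite !big_cat big_cons big_map /= !mulgA; congr (_ * _).
  by rewrite -conjg_prod -conjgC.
move=> p pt; rewrite !count_cat /= count_map addnCA; congr (_ + (_ + _))%N.
by apply: eq_count => x /=; rewrite pt.
Qed.

Lemma pull_power t k w : (k <= count_mem t w)%N -> exists w',
  \prod_(x <- w) x = t ^+ k * \prod_(x <- w') x /\
  forall p : pred G, (forall x, p (x ^ t) = p x) ->
    count p w = (k * p t + count p w')%N.
Proof.
elim: k => [|k IHk] kw; first by exists w; rewrite mul1g.
have [w1 [-> w1E]] := IHk (ltnW kw).
(* Conjugation by [t] fixes [t], so the earlier moves leave the remaining occurrences of [t]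
   available. *)
have t1 x : pred1 t (x ^ t) = pred1 t x.
  by rewrite /= -(inj_eq (@conjg_inj _ t) x t) [t ^ t]conjgE mulKg.
have [|w2 [-> w2E]] := @pull_letter t w1.
  rewrite -has_pred1 has_count; move: kw; rewrite w1E //= eqxx muln1.
  by rewrite -addn1 leq_add2l.
exists w2; split; first by rewrite expgSr mulgA.
by move=> p pt; rewrite w1E // w2E // mulSnr addnA.
Qed.

Definition expgz x (k : int) :=
  match k with Posz n => x ^+ n | Negz n => x ^- n.+1 end.

Lemma expgzS x k : expgz x (k + 1)%R = x * expgz x k.
Proof.
case: k => [n|[|n]]; first by rewrite /= addn1 expgS.
  by rewrite /= mulgV.
have -> : (Negz n.+1 + 1)%R = Negz n by lia.
by rewrite /= [in RHS]expgSr invgM mulVKg.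
Qed.

Lemma prod_expgzS (r : seq G) (a : G -> int) z :
    uniq r -> z \in r -> (forall y, commute z y) ->
  \prod_(y <- r) expgz y (a y + (z == y)%:Z)%R =
  z * \prod_(y <- r) expgz y (a y).
Proof.
move=> + + cz; elim: r => //= y r IHr /andP[yr ur]; rewrite inE !big_cons.
case: (eqVneq z y) yr => [<- yr _|zy yr /= zr].
  rewrite expgzS -mulgA; congr (_ * (_ * _)); apply: eq_big_seq => y' y'r.
  by case: eqVneq => [zy'|]; rewrite ?addr0 //; rewrite zy' y'r in yr.
by rewrite addr0 IHr // !mulgA cz.
Qed.

(* [exponent_sum s c e g]: some word in the letters of [s] and their inverses
   has value [g] and, for each [z], [e z] is the signed number of its letters
   of colour [z]. *)
Inductive exponent_sum s (c : G -> G) : (G -> int) -> G -> Prop :=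
| exponent_sum1 : exponent_sum s c (fun=> 0%R) 1
| exponent_sumM e e' g g' : exponent_sum s c e g -> exponent_sum s c e' g' ->
    exponent_sum s c (fun z => e z + e' z)%R (g * g')
| exponent_sumV e g : exponent_sum s c e g ->
    exponent_sum s c (fun z => - e z)%R g^-1
| exponent_sum_letter x : x \in s ->
    exponent_sum s c (fun z => Posz (c x == z)) x.

Lemma exponent_sum_ex s c g :
  generating [set` s] -> exists e, exponent_sum s c e g.
Proof.
move=> gens; have : generated_subgroup [set` s] g by rewrite gens.
elim/generated_subgroup_ind => {g} [|x y [e xe] [e' ye]|x [e xe]|x xs].
- by eexists; apply: exponent_sum1.
- by eexists; apply: exponent_sumM xe ye.
- by eexists; apply: exponent_sumV xe.
- by eexists; apply: exponent_sum_letter xs.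
Qed.

Lemma exponent_sum_derived s c g : generating [set` s] ->
  derived_subgroup G g -> exponent_sum s c (fun=> 0%R) g.
Proof.
move=> gens; elim/generated_subgroup_ind => {g}
  [|x y xe ye|x xe|_ [x _ [y _ <-]]].
- exact: exponent_sum1.
- exact: exponent_sumM xe ye.
- exact: exponent_sumV xe.
- have [e xe] := exponent_sum_ex c x gens.
  have [e' ye] := exponent_sum_ex c y gens.
  have := exponent_sumM (exponent_sumV xe)
    (exponent_sumM (exponent_sumV ye) (exponent_sumM xe ye)).
  by congr exponent_sum; apply: funext => z; lia.
Qed.

(** * Normal form: central powers times a bounded word *)

Section NormalForm.
Variables (s : seq G) (m : nat).
Hypotheses (sJ : forall x y, x \in s -> x ^ y \in s) (m_gt0 : (0 < m)%N).
Hypothesis cm : forall x y, x \in s -> commute (x ^+ m) y.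

(** The colour of [x] in [s] is the central power [x ^+ m], unchanged when [x] is conjugated. [cnt]
    also tests membership in [s], which makes its predicate conjugation invariant on all of [G]. *)
Let Z := undup [seq x ^+ m | x <- s].
Let Phi (a : G -> int) := \prod_(z <- Z) expgz z (a z).
Let cnt z w := count (fun x => (x \in s) && (x ^+ m == z)) w.

(** A factor [z] of [Phi a] counts as [m] letters of colour [z]. Formal inverses of letters are
    absorbed by negative values of [a], so [u] is a word in [s] alone. *)
Definition normal_form (e : G -> int) g := exists a u,
  [/\ all (mem s) u, (size u <= size s * m)%N,
      g = Phi a * \prod_(x <- u) x &
      forall z, z \in Z -> e z = (a z * m%:Z + (cnt z u)%:Z)%R].

Lemma normal_form_ext e e' g :
  e =1 e' -> normal_form e g -> normal_form e' g.
Proof.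
by move=> ee [a [u [us uL gE eE]]]; exists a, u; split=> // z /eE <-.
Qed.

Lemma mem_central_power x : x \in s -> x ^+ m \in Z.
Proof. by move=> xs; rewrite mem_undup (map_f (fun y => y ^+ m)). Qed.

Lemma Phi_shift (a : G -> int) x : x \in s ->
  Phi (fun z => a z + (x ^+ m == z)%g%:Z)%R = x ^+ m * Phi a.
Proof.
move=> xs; rewrite /Phi (prod_expgzS a) ?undup_uniq ?mem_central_power // => y.
exact: cm.
Qed.

Lemma normal_formM e g x : x \in s -> normal_form e g ->
  normal_form (fun z => e z + (x ^+ m == z)%g%:Z)%R (g * x).
Proof.
move=> xs [a [u [us uL gE eE]]].
have gxE : g * x = Phi a * \prod_(y <- rcons u x) y.
  by rewrite big_rcons /= gE -mulgA.
have uxs : all (mem s) (rcons u x) by rewrite all_rcons us /= xs.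
have cntE z : cnt z (rcons u x) = (cnt z u + (x ^+ m == z))%N.
  by rewrite /cnt -cats1 count_cat /= xs addn0.
have [uxL|uxL] := leqP (size (rcons u x)) (size s * m).
  by exists a, (rcons u x); split=> // z /eE ->; rewrite cntE; lia.
(* The word exceeds the bound by one letter, so splitting off [t ^+ m] with [m] positive brings it
   back within the bound. *)
have [t ts /ltnW tm] := pigeonhole_count uxs uxL.
have [w [uxw wE]] := pull_power tm.
have sJE y : (y ^ t \in s) = (y \in s).
  by apply/idP/idP => [yts|/sJ//]; rewrite -(conjgK t y); apply: sJ.
have sw : (size (rcons u x) = m + size w)%N.
  by rewrite -!(count_predT) (wE predT) //= muln1.
exists (fun z => a z + (t ^+ m == z)%g%:Z)%R, w; split.
- rewrite all_count; move: uxs; rewrite all_count wE // sw.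
  by move: ts => /= ->; rewrite muln1 eqn_add2l.
- by move: sw; rewrite size_rcons; lia.
- by rewrite gxE uxw Phi_shift // mulgA; congr (_ * _); rewrite cm.
- move=> z zZ; have := cntE z; rewrite {1}/cnt wE; last first.
    move=> y; rewrite sJE; case: (boolP (y \in s)) => //= ys.
    by rewrite -conjXg /conjg cm // mulKg.
  rewrite ts /= eE // -/(cnt z w); nia.
Qed.

(** As [x^-1] equals [(x ^+ m)^-1 * x ^+ m.-1], one appends [m.-1] letters [x] and lowers the
    exponent of [x ^+ m] by one. *)
Lemma normal_formV e g x : x \in s -> normal_form e g ->
  normal_form (fun z => e z - (x ^+ m == z)%g%:Z)%R (g * x^-1).
Proof.
move=> xs ge.
have [a [u [us uL gE eE]]] : normal_form
    (fun z => e z + m.-1%:Z * (x ^+ m == z)%g%:Z)%R (g * x ^+ m.-1).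
  elim: m.-1 => [|k IHk].
    by rewrite mulg1; apply: normal_form_ext ge => z; rewrite mul0r addr0.
  rewrite expgSr mulgA; apply: normal_form_ext (normal_formM xs IHk) => z.
  nia.
exists (fun z => a z - (x ^+ m == z)%g%:Z)%R, u; split=> //.
  have aE : Phi a = x ^+ m * Phi (fun z => a z - (x ^+ m == z)%g%:Z)%R.
    rewrite -Phi_shift //; congr Phi; apply: funext => z; ring.
  have : g * x^-1 * x ^+ m = Phi a * \prod_(y <- u) y.
    by rewrite -gE -[in LHS](prednK m_gt0) expgS mulgA mulgVK.
  rewrite aE -(cm _ xs) => /(congr1 (fun y => (x ^+ m)^-1 * y)).
  by rewrite -!mulgA !mulKg.
by move=> z /eE; nia.
Qed.

Lemma exponent_sum_normal_form e g :
  exponent_sum s (fun x => x ^+ m) e g -> normal_form e g.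
Proof.
(* Multiplication by [g] and by [g^-1] is treated simultaneously, since the case of an inverse
   exchanges the two. *)
move=> ge; suff : forall e' g', normal_form e' g' ->
    normal_form (fun z => e' z + e z)%R (g' * g) /\
    normal_form (fun z => e' z - e z)%R (g' * g^-1).
  have nf1 : normal_form (fun=> 0%R) 1.
    exists (fun=> 0%R), [::]; split=> //.
    by rewrite big_nil mulg1 /Phi big1.
  move=> /(_ _ _ nf1)[nf _]; rewrite -[g]mul1g.
  by apply: normal_form_ext nf => z; rewrite add0r.
elim: ge => {e g} [|e1 e2 g1 g2 _ IH1 _ IH2|e1 g1 _ IH1|x xs] e g ge.
- by rewrite invg1 mulg1; split; apply: normal_form_ext ge => z; lia.
- split.
    rewrite mulgA; apply: normal_form_ext (IH2 _ _ (IH1 _ _ ge).1).1 => z; lia.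
  rewrite invgM mulgA.
  by apply: normal_form_ext (IH1 _ _ (IH2 _ _ ge).2).2 => z; lia.
- split; first exact: (IH1 _ _ ge).2.
  by rewrite invgK; apply: normal_form_ext (IH1 _ _ ge).1 => z; lia.
- by split; [apply: normal_formM | apply: normal_formV].
Qed.

(* The exponents are determined by the bounded word: they are minus its colour
   counts divided by [m]. *)
Lemma finite_normal_form0 : finite_set [set g | normal_form (fun=> 0%R) g].
Proof.
pose value u := Phi (fun z => (- (cnt z u)%:Z %/ m%:Z)%Z) * \prod_(x <- u) x.
apply: (@sub_finite_set _ _
  (value @` [set u : seq G | all (mem s) u /\ (size u <= size s * m)%N])).
  move=> g [a [u [us uL -> aE]]]; exists u => //; congr (_ * _).
  apply: eq_big_seq => z /aE /eqP; rewrite eq_sym addr_eq0 => /eqP <-.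
  by rewrite mulzK // -lt0n.
exact/finite_image/finite_bounded_words.
Qed.

End NormalForm.

Lemma finite_derived_subgroup (S : set G) : finite_set S -> generating S ->
  conj_invariant S -> finite_set (derived_subgroup G).
Proof.
move=> /finite_seqP[s ->] gens sJ.
have sJ' x y : x \in s -> x ^ y \in s.
  move=> xs; suff : [set` s] (x ^ y) by [].
  by rewrite -(sJ y^-1); exists x; rewrite // invgK -mulgA.
have [m m_gt0 cm] := exponent_central sJ' gens.
apply: sub_finite_set (finite_normal_form0 s m_gt0) => g Dg.
by apply: exponent_sum_normal_form => //; apply: exponent_sum_derived.
Qed.

End Groups.

(** * Finitely generated abelian groups *)

Section LinearCombinations.
Local Open Scope ring_scope.
Variable A : zmodType.
Implicit Types (x : nat -> A) (c : nat -> int) (a b : A) (L : seq A).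

(** Families are functions on [nat] of which only the first [n] values count, so that adjoining an
    element does not change their type. *)
Definition lincomb n x c := \sum_(i < n) x i *~ c i.

Definition Zindependent n x :=
  forall c, lincomb n x c = 0 -> forall i, (i < n)%N -> c i = 0.

Lemma lincombD n x c c' :
  lincomb n x (fun i => c i + c' i) = lincomb n x c + lincomb n x c'.
Proof. by rewrite -big_split; apply: eq_bigr => i _; rewrite mulrzDr. Qed.

Lemma lincombMz n x c (k : int) :
  lincomb n x (fun i => c i * k) = lincomb n x c *~ k.
Proof. by rewrite mulrz_suml; apply: eq_bigr => i _; rewrite mulrzA. Qed.

Lemma lincombN n x c : lincomb n x (fun i => - c i) = - lincomb n x c.
Proof.
by rewrite -mulrN1z -lincombMz; apply: eq_bigr => i _; rewrite mulrN1.
Qed.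

Lemma lincomb0 n x : lincomb n x (fun=> 0) = 0.
Proof. exact: big1. Qed.

Lemma Zindependent_inj n x c c' : Zindependent n x ->
  lincomb n x c = lincomb n x c' -> forall i, (i < n)%N -> c i = c' i.
Proof.
move=> xI cc' i lt_in; apply/eqP; rewrite -subr_eq0; apply/eqP.
by apply: (xI (fun i => c i - c' i)); rewrite // lincombD lincombN cc' subrr.
Qed.

(* [x] is a maximal independent subfamily of [L]; its span has finite index in
   that of [L], [m] is an exponent of the quotient and [F] a set of
   representatives. *)
Lemma finitely_generated_structure L :
  exists n x m (F : seq A), [/\ (0 < m)%N, Zindependent n x &
    forall l, let a := lincomb (size L) (nth 0 L) l in
      (exists c, a *+ m = lincomb n x c) /\
      (exists c, exists2 f, f \in F & a = lincomb n x c + f)].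
Proof.
elim: L => [|s L [n [x [m [F [m_gt0 xI spanL]]]]]].
  exists 0%N, (fun=> 0), 1%N, [:: 0]; split=> // l /=.
  rewrite /lincomb !big_ord0; split; exists (fun=> 0).
    by rewrite big_ord0.
  by exists 0; rewrite ?inE // big_ord0 addr0.
have sLE l : lincomb (size (s :: L)) (nth 0 (s :: L)) l =
    s *~ l 0 + lincomb (size L) (nth 0 L) (l \o succn).
  by rewrite /lincomb big_ord_recl.
(* If a positive multiple [s *+ k] lies in the span of [x], then [x] is kept, the exponent is
   multiplied by [k], and division of the coefficient of [s] by [k] yields the new representatives.
   Otherwise [s] is adjoined to [x]. *)
case: (pselect (exists2 k, (0 < k)%N & exists d, s *+ k = lincomb n x d)).
  move=> [k k_gt0 [d sd]].
  exists n, x, (m * k)%N, [seq f + s *+ r | f <- F, r <- iota 0 k].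
  split=> [||l]; rewrite ?muln_gt0 ?m_gt0 // sLE /=.
  have [[c cE] [c' [f fF c'E]]] := spanL (l \o succn); split.
    exists (fun i => d i * (l 0 * m%:Z) + c i * k%:Z).
    rewrite lincombD !lincombMz -cE -sd mulrnDl.
    rewrite -!pmulrn !mulrnA; congr (_ + _).
    by rewrite !pmulrn -!mulrzA; congr (_ *~ _); lia.
  exists (fun i => d i * (l 0%N %/ k%:Z)%Z + c' i).
  exists (f + s *+ `|(l 0%N %% k%:Z)%Z|%N).
    apply: allpairs_f => //; rewrite mem_iota /= add0n.
    by rewrite -ltz_nat gez0_abs ?modz_ge0 ?ltz_pmod //; lia.
  rewrite lincombD lincombMz -sd c'E.
  rewrite {1}(divz_eq (l 0%N) k%:Z) mulrzDr.
  set r := (_ %% _)%Z; have r_ge0 : 0 <= r by apply: modz_ge0; lia.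
  rewrite [s *+ `|r|]pmulrn gez0_abs // [_ * k%:Z]mulrC mulrzA -pmulrn.
  by rewrite addrACA [s *~ r + f]addrC.
move=> nk.
pose x' i := if i == n then s else x i.
have x'E c : lincomb n.+1 x' c = lincomb n x c + s *~ c n.
  rewrite /lincomb big_ord_recr /= /x' eqxx; congr (_ + _).
  by apply: eq_bigr => i _; rewrite (ltn_eqF (ltn_ord i)).
exists n.+1, x', m, F; split=> // [c|l].
  (* A nonzero coefficient of [s] would give a positive multiple excluded by [nk]; its sign decides
     whether the relation is negated. *)
  rewrite x'E => c0; have cn0 : c n = 0.
    apply: contrapT => cn; apply: nk; exists `|c n|%N; first by lia.
    have [cn_gt0|cn_lt0] := ltP 0 (c n).
      exists (fun i => - c i); rewrite lincombN pmulrn gez0_abs ?ltW //.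
      by apply/eqP; rewrite -addr_eq0 addrC c0.
    exists c; rewrite pmulrn lez0_abs // mulrNz.
    by apply/eqP; rewrite eqr_oppLR -addr_eq0 addrC c0.
  move=> i; rewrite ltnS leq_eqVlt => /orP[/eqP->//|].
  by apply: xI; rewrite -c0 cn0 addr0.
have extE c k : lincomb n.+1 x' (fun i => if i == n then k else c i) =
    lincomb n x c + s *~ k.
  rewrite x'E eqxx; congr (_ + _).
  by apply: eq_bigr => i _; rewrite (ltn_eqF (ltn_ord i)).
rewrite sLE /=; have [[c cE] [c' [f fF c'E]]] := spanL (l \o succn); split.
  exists (fun i => if i == n then l 0 * m%:Z else c i).
  by rewrite extE -cE mulrnDl addrC mulrzA.
exists (fun i => if i == n then l 0 else c' i), f => //.
by rewrite extE c'E addrCA addrA.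
Qed.

End LinearCombinations.

(** * Homomorphisms with finite kernel and image of finite index *)

Section WordLength.
Local Open Scope group_scope.
Variables (G : groupType) (S : set G).
Hypothesis genS : generating S.
Implicit Types (x y g : G) (u v w : seq G).

Lemma is_word_cat u v : is_word S u -> is_word S v -> is_word S (u ++ v).
Proof. by move=> wu wv x; rewrite mem_cat => /orP[/wu|/wv]. Qed.

Lemma generating_word g : exists2 w, is_word S w & \prod_(x <- w) x = g.
Proof.
have : generated_subgroup S g by rewrite genS.
by case=> w ww wg; exists w.
Qed.

(** The infimum runs over a nonempty set of natural numbers, so it is a minimum. *)
Lemma word_dist_attained (R : realType) x y : exists w,
  [/\ is_word S w, \prod_(s <- w) s = x^-1 * y &
      word_dist R S x y = (size w)%:R%R].
Proof.
pose P n := `[< exists w,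
  [/\ is_word S w, \prod_(s <- w) s = x^-1 * y & size w = n] >].
have exP : exists n, P n.
  have [w ww wE] := generating_word (x^-1 * y).
  by exists (size w); apply/asboolP; exists w.
have [_ /asboolP[w [ww wE <-]] wmin] := ex_minnP exP.
exists w; split=> //; apply/le_anti/andP; split; rewrite /word_dist.
  apply: ge_inf; last by exists w.
  by exists 0%R => _ [v _ <-]; rewrite ler0n.
apply: lb_le_inf; first by exists (size w)%:R%R, w.
move=> _ [v [vw vE] <-]; rewrite ler_nat; apply: wmin.
by apply/asboolP; exists v.
Qed.

Lemma word_dist_le (R : realType) x y w : is_word S w ->
  \prod_(s <- w) s = x^-1 * y -> (word_dist R S x y <= (size w)%:R)%R.
Proof.
move=> ww wE; apply: ge_inf; last by exists w.
by exists 0%R => _ [v _ <-]; rewrite ler0n.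
Qed.

(** This bound is the source of all constants of the quasi-isometry. *)
Lemma finite_set_word_bound (B : set G) : finite_set B ->
  exists N, forall g, B g ->
    exists w, [/\ is_word S w, \prod_(x <- w) x = g & (size w <= N)%N].
Proof.
move=> /finite_seqP[b ->].
have /choice[word wordP] g : exists w, is_word S w /\ \prod_(x <- w) x = g.
  by have [w] := generating_word g; exists w.
exists (\max_(g <- b) size (word g))%N => g gb; exists (word g).
by have [ww wg] := wordP g; split=> //; apply: leq_bigmax_seq.
Qed.

End WordLength.

Section FiniteKernel.
Local Open Scope group_scope.
Variables (G H : groupType) (phi : G -> H).
Hypotheses (phiM : {morph phi : x y / x * y})
           (finK : finite_set [set g | phi g = 1]).

Let phi1 : phi 1 = 1.
Proof. by apply: (mulgI (phi 1)); rewrite -phiM !mulg1. Qed.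

Let phiV x : phi x^-1 = (phi x)^-1.
Proof. by apply: (mulgI (phi x)); rewrite -phiM !mulgV. Qed.

(** Each nonempty fibre is a translate of the kernel by [lift], which takes the default value 1 off
    the image of [phi]. *)
Lemma finite_preimage_hom (B : set H) :
  finite_set B -> finite_set (phi @^-1` B).
Proof.
move=> finB.
have /choice[lift liftP] h : exists g, (exists x, phi x = h) -> phi g = h.
  have [[g gh]|nh] := pselect (exists g, phi g = h); first by exists g.
  by exists 1 => /nh.
apply: (@sub_finite_set _ _
  [set lift h * k | h in B & k in [set g | phi g = 1]]).
  move=> g /= Bg; exists (phi g) => //; exists ((lift (phi g))^-1 * g).
    by rewrite /= phiM phiV liftP ?mulVg //; exists g.
  by rewrite mulVKg.
exact: finite_image2.
Qed.

(** By [FP] every element of [H] is [phi g * f] with [f] in the finite set [F]: the image has finite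
    index. *)
Variables (S : set G) (T : set H) (F : set H).
Hypotheses (finS : finite_set S) (genS : generating S).
Hypotheses (finT : finite_set T) (genT : generating T).
Hypotheses (finF : finite_set F) (FP : forall h, exists g, F ((phi g)^-1 * h)).

Let finite_letters (K : groupType) (U : set K) : finite_set U ->
  finite_set [set x | U x \/ U x^-1].
Proof.
move=> finU; apply: (@sub_finite_set _ _ (U `|` [set x^-1 | x in U])).
  by move=> x [Ux|Ux]; [left | right; exists x^-1; rewrite ?invgK].
by rewrite finite_setU; split=> //; apply: finite_image.
Qed.

Lemma hom_word_upper_bound : exists N, forall u, is_word S u ->
  exists v, [/\ is_word T v, \prod_(x <- v) x = phi (\prod_(x <- u) x) &
    (size v <= N * size u)%N].
Proof.
have [N NP] := finite_set_word_bound genT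
  (finite_image phi (finite_letters finS)).
exists N; elim=> [_|x u IHu xu].
  by exists [::]; split=> //; rewrite !big_nil phi1.
have [|v [vT vE vN]] := IHu.
  by move=> y yu; apply: xu; rewrite inE yu orbT.
have [|w [wT wE wN]] := NP (phi x).
  by exists x => //; apply: xu; rewrite mem_head.
exists (w ++ v); split; first exact: is_word_cat.
  by rewrite big_cat big_cons phiM wE vE.
by rewrite size_cat mulnS leq_add.
Qed.

(* Lifting a word of [H] letter by letter along the finite-index image of
   [phi]: the error in [F] is carried to the next letter. *)
Lemma hom_word_lower_bound : exists N N', forall g v, is_word T v ->
  \prod_(x <- v) x = phi g ->
  exists u, [/\ is_word S u, \prod_(x <- u) x = g &
    (size u <= N * size v + N')%N].
Proof.
have /choice[lift liftP] := FP.
pose E := [set f * t | f in F & t in [set t | T t \/ T t^-1]].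
have finE : finite_set E by apply: finite_image2 => //; apply: finite_letters.
(* [N] bounds the cost of one letter of [v], [N1] that of the initial [lift 1], whose error against
   1 lies in [F], and [N2] that of the final correction. *)
have [N NP] := finite_set_word_bound genS (finite_image lift finE).
have [N1 N1P] := finite_set_word_bound genS (finite_set1 (lift 1)).
have [N2 N2P] := finite_set_word_bound genS (finite_preimage_hom finF).
exists N, (N1 + N2)%N => g v vT vE.
suff [u [uS uF uN]] : exists u, [/\ is_word S u,
    F ((phi (\prod_(x <- u) x))^-1 * \prod_(x <- v) x) &
    (size u <= N * size v + N1)%N].
  have [|w [wS wE wN]] := N2P ((\prod_(x <- u) x)^-1 * g).
    by rewrite /= phiM phiV -vE.
  exists (u ++ w); split; first exact: is_word_cat.
    by rewrite big_cat /= wE mulVKg.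
  by rewrite size_cat addnA leq_add.
elim/last_ind: v vT {vE} => [_|v t IHv vT].
  have [//|w [wS wE wN]] := N1P (lift 1).
  by exists w; split; rewrite ?wE ?big_nil ?muln0.
have [|u [uS uF uN]] := IHv.
  by move=> x xv; apply: vT; rewrite mem_rcons inE xv orbT.
have tT : T t \/ T t^-1 by apply: vT; rewrite mem_rcons mem_head.
(* With the error [f] carried over, the next letter asks for [f * t]; appending a word for
   [lift (f * t)] leaves an error in [F] again. *)
set f := _ * _ in uF.
have [|w [wS wE wN]] := NP (lift (f * t)).
  by exists (f * t) => //; exists f => //; exists t.
exists (u ++ w); split; first exact: is_word_cat.
  rewrite big_cat /= wE big_rcons /= phiM invgM -mulgA [X in _ * X]mulgA.
  exact: liftP.
by rewrite size_cat size_rcons mulnS -addnA addnC leq_add.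
Qed.

Lemma hom_quasi_isometry (R : realType) :
  is_quasi_isometry (word_dist R S) (word_dist R T) phi.
Proof.
have [N NP] := hom_word_upper_bound.
have [M [M' MP]] := hom_word_lower_bound.
(* The distance from [h] to [phi g] is the length of [h^-1 * phi g], the inverse of an element of
   [F]. *)
have [C CP] :=
  finite_set_word_bound genT (finite_image (fun h : H => h^-1) finF).
have phiVM x y : phi (x^-1 * y) = (phi x)^-1 * phi y by rewrite phiM phiV.
(* One constant dominates both slopes [N] and [M]; the summand 1 ensures that it is at least 1. *)
set A : R := (N + M + 1)%:R%R.
have A_ge1 : (1 <= A)%R by rewrite /A natrD lerDr ler0n.
have A_gt0 : (0 < A)%R by apply: lt_le_trans A_ge1.
exists A, M'%:R%R, C%:R%R; split; first by rewrite !ler0n.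
  move=> x y; apply/andP; split.
    have [v [vT vE ->]] := word_dist_attained genT R (phi x) (phi y).
    have [|u [uS uE uN]] := MP (x^-1 * y) v vT; first by rewrite phiVM.
    rewrite lerBlDr mulrC ler_pdivrMr //.
    apply: le_trans (word_dist_le R uS uE) _.
    rewrite -natrD -natrM ler_nat; nia.
  have [u [uS uE ->]] := word_dist_attained genS R x y.
  have [v [vT vE vN]] := NP u uS.
  apply: le_trans (word_dist_le R vT _) _; first by rewrite vE uE phiVM.
  rewrite -natrM -natrD ler_nat; nia.
move=> h; have [g gF] := FP h; exists g.
have [|v [vT vE vC]] := CP (((phi g)^-1 * h)^-1).
  by exists ((phi g)^-1 * h).
apply: le_trans (word_dist_le R vT _) _; first by rewrite vE invgM invgK.
by rewrite ler_nat.
Qed.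

End FiniteKernel.

(** * Rank of the abelianization *)

Section TensorQPureTensors.
Local Open Scope ring_scope.
Variable A : zmodType.
Implicit Types (a b : A) (q : rat) (s t : seq (A * rat)).

Lemma tensorQ_piD s t :
  tensorQ_pi (s ++ t) = tensorQ_pi s + tensorQ_pi t :> tensorQ A.
Proof. by symmetry; apply: tensorQ_addE. Qed.

Lemma tensorQ_piDl a b q :
  tensorQ_pi [:: (a + b, q)] =
  tensorQ_pi [:: (a, q)] + tensorQ_pi [:: (b, q)] :> tensorQ A.
Proof. by rewrite -tensorQ_piD; apply/tensorQ_piP/asboolP/tensorQ_Dl. Qed.

Lemma tensorQ_pi0l q : tensorQ_pi [:: (0 : A, q)] = 0 :> tensorQ A.
Proof. exact/tensorQ_piP/asboolP/tensorQ_0l. Qed.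

Lemma tensorQ_piZ a p q :
  tensorQ_pi [:: (a, p * q)] = p *: (tensorQ_pi [:: (a, q)] : tensorQ A).
Proof. by symmetry; apply: tensorQ_scaleE. Qed.

Lemma tensorQ_piMz a k q :
  tensorQ_pi [:: (a *~ k, q)] = k%:~R *: (tensorQ_pi [:: (a, q)] : tensorQ A).
Proof.
rewrite scaler_int.
have piN : tensorQ_pi [:: (- a, q)] = - tensorQ_pi [:: (a, q)] :> tensorQ A.
  by apply/eqP; rewrite -addr_eq0 -tensorQ_piDl addNr tensorQ_pi0l.
have piMn b j :
    tensorQ_pi [:: (b *+ j, q)] = (tensorQ_pi [:: (b, q)] : tensorQ A) *+ j.
  elim: j => [|j IHj]; first exact: tensorQ_pi0l.
  by rewrite !mulrS tensorQ_piDl IHj.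
by case: k => j; rewrite ?NegzE ?mulrNz -!pmulrn -?mulNrn piMn ?piN.
Qed.

Lemma tensorQ_pi_sum (I : finType) (a : I -> A) q :
  tensorQ_pi [:: (\sum_i a i, q)] =
  \sum_i (tensorQ_pi [:: (a i, q)] : tensorQ A).
Proof.
apply: (big_morph (fun a => tensorQ_pi [:: (a, q)] : tensorQ A)).
  by move=> a1 a2; apply: tensorQ_piDl.
exact: tensorQ_pi0l.
Qed.

End TensorQPureTensors.

(* [psi a] is the row of coordinates of [m a] in the independent family [x]. *)
Section RationalCoordinates.
Local Open Scope ring_scope.
Variables (A : zmodType) (n : nat) (x : nat -> A) (m : nat).
Hypotheses (m_gt0 : (0 < m)%N) (xI : Zindependent n x).
Variable psi : A -> 'rV[int]_n.
Hypothesis psiE : forall a, a *+ m = \sum_(i < n) x i *~ psi a 0 i.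

Lemma coordinates_uniq a (c : 'I_n -> int) :
  a *+ m = \sum_(i < n) x i *~ c i -> forall i, psi a 0 i = c i.
Proof.
rewrite psiE => E i.
(* Independence concerns coefficients indexed by [nat], so those on ['I_n] are extended by 0. *)
pose ext (f : 'I_n -> int) k := oapp f 0 (insub k).
have extE f : lincomb n x (ext f) = \sum_(i < n) x i *~ f i.
  by apply: eq_bigr => k _; rewrite /ext valK.
have := Zindependent_inj xI
  (etrans (extE (psi a 0)) (etrans E (esym (extE c)))).
by move=> /(_ i (ltn_ord i)); rewrite /ext valK.
Qed.

(** [psi] is only a choice of coefficients; their uniqueness forces additivity. *)
Lemma coordinatesD a b : psi (a + b) = psi a + psi b.
Proof.
apply/rowP => i; apply: (coordinates_uniq (c := fun i => (psi a + psi b) 0 i)).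
rewrite mulrnDl !psiE -big_split; apply: eq_bigr => j _.
by rewrite mxE mulrzDr.
Qed.

Lemma coordinates0 : psi 0 = 0.
Proof. by apply: (addrI (psi 0)); rewrite -coordinatesD !addr0. Qed.

(** Hence the image of [psi] contains all multiples of [m] in the lattice, which gives finite
    index. *)
Lemma coordinates_sum (c : 'I_n -> int) :
  psi (\sum_(i < n) x i *~ c i) = \row_i (c i * m%:Z).
Proof.
apply/rowP => i; rewrite mxE.
apply: (coordinates_uniq (c := fun i => c i * m%:Z)).
by rewrite pmulrn mulrz_suml; apply: eq_bigr => j _; rewrite mulrzA.
Qed.

(** If [psi] kills a combination of [x] plus [f], then [m] times the coefficients is [- psi f], so
    [f] determines the element. *)
Lemma finite_coordinates_kernel (F : seq A) :
  (forall a, exists c, exists2 f, f \in F & a = lincomb n x c + f) ->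
  finite_set [set a | psi a = 0].
Proof.
move=> FP.
pose lift f := \sum_(i < n) x i *~ (- psi f ord0 i %/ m%:Z)%Z + f.
apply: (@sub_finite_set _ _ (lift @` [set` F])); last first.
  exact/finite_image/finite_seq.
move=> a; have [c [f fF ->]] := FP a; rewrite /= coordinatesD => psi0.
exists f => //; congr (_ + _); apply: eq_bigr => i _; congr (_ *~ _).
have /rowP/(_ i) := psi0; rewrite coordinates_sum !mxE => /eqP.
by rewrite addrC addr_eq0 => /eqP ->; rewrite opprK mulzK // -lt0n.
Qed.

(** This is the rational extension of the [i]-th entry of [psi] to formal sums; it descends to the
    tensor product by [coordQ_cong]. *)
Let coordQ (i : 'I_n) (s : seq (A * rat)) : rat :=
  \sum_(p <- s) (psi p.1 0 i)%:~R * p.2.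

Lemma coordQ_cong i s t : tensorQ_cong s t -> coordQ i s = coordQ i t.
Proof.
rewrite /coordQ; elim=> {s t} //.
- by move=> s t u _ -> _ ->.
- by move=> s s' t t' _ ss' _ tt'; rewrite !big_cat ss' tt'.
- by move=> s t; rewrite !big_cat /= addrC.
- by move=> q; rewrite big_seq1 big_nil coordinates0 mxE mul0r.
- by move=> a; rewrite big_seq1 big_nil mulr0.
- move=> a b q; rewrite big_seq1 big_cons big_seq1 /= coordinatesD mxE.
  by rewrite rmorphD mulrDl.
- by move=> a q r; rewrite big_seq1 big_cons big_seq1 /= mulrDr.
Qed.

Let coord i (v : tensorQ A) := coordQ i (repr v).

Lemma coord_pi i s : coord i (tensorQ_pi s) = coordQ i s.
Proof. exact/coordQ_cong/tensorQ_cong_repr. Qed.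

Lemma coordD i u v : coord i (u + v) = coord i u + coord i v.
Proof.
rewrite -(tensorQ_pi_repr u) -(tensorQ_pi_repr v) -tensorQ_piD !coord_pi.
by rewrite /coordQ big_cat.
Qed.

Lemma coordZ i q v : coord i (q *: v) = q * coord i v.
Proof.
rewrite -(tensorQ_pi_repr v) [X in coord i X]tensorQ_scaleE !coord_pi.
rewrite /coordQ big_map mulr_sumr; apply: eq_bigr => p _ /=.
by rewrite mulrCA.
Qed.

(** The tensors of the [x i] with 1 form a basis. They span because [(a, q)] and
    [(a *+ m, q / m%:R)] are the same tensor; the functionals [coord i], equal to [m] or 0 on them,
    make coefficients unique. *)
Lemma has_rank_coordinates : has_rank A n.
Proof.
have m_neq0 : m%:R != 0 :> rat by rewrite pnatr_eq0 -lt0n.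
pose e (i : 'I_n) : tensorQ A := tensorQ_pi [:: (x i, 1)].
have coord_e i j : coord i (e j) = (i == j)%:R * m%:R.
  rewrite coord_pi /coordQ big_seq1 mulr1 /=.
  rewrite (coordinates_uniq (c := fun i => (i == j)%:Z * m%:Z)).
    by rewrite rmorphM /= -!pmulrn.
  rewrite (bigD1 j) //= eqxx mul1r big1 ?addr0 // => k /negbTE ->.
  by rewrite mul0r.
have coord0 i : coord i 0 = 0 by rewrite -(scale0r 0) coordZ mul0r.
have coord_sum (c : 'rV_n) i : coord i (\sum_j c 0 j *: e j) = c 0 i * m%:R.
  rewrite (big_morph (coord i) (coordD i) (coord0 i)) (bigD1 i) //=.
  rewrite coordZ coord_e eqxx mul1r big1 ?addr0 // => j ji.
  by rewrite coordZ coord_e eq_sym (negbTE ji) mul0r mulr0.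
have e_span v : exists c : 'rV_n, v = \sum_i c 0 i *: e i.
  rewrite -(tensorQ_pi_repr v); elim: (repr v) => [|[a q] s [c cE]].
    by exists 0; rewrite big1 // => i _; rewrite mxE scale0r.
  exists (\row_i ((psi a 0 i)%:~R * (q / m%:R)) + c).
  rewrite -cat1s tensorQ_piD cE.
  under [RHS]eq_bigr do rewrite !mxE scalerDl.
  rewrite big_split; congr (_ + _).
  have -> : tensorQ_pi [:: (a, q)] = tensorQ_pi [:: (a *+ m, q / m%:R)].
    by rewrite pmulrn tensorQ_piMz -tensorQ_piZ -pmulrn mulrC divfK.
  rewrite psiE tensorQ_pi_sum; apply: eq_bigr => i _.
  by rewrite tensorQ_piMz -{1}[q / _]mulr1 tensorQ_piZ scalerA.
exists e => v; have [c cE] := e_span v; exists c; split=> // c' c'E.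
apply/rowP => i; apply: (mulIf m_neq0).
by rewrite -!coord_sum -cE -c'E.
Qed.

End RationalCoordinates.

(** * The lattice [Zn n] *)

Section IntegerLattice.
Local Open Scope ring_scope.

(** For positive [m] the box represents the lattice modulo [m]; it will serve as the set [F] of
    errors. *)
Lemma finite_box n m :
  finite_set [set v : 'rV[int]_n | forall i, 0 <= v 0 i < m%:Z].
Proof.
pose f (r : 'rV['I_m]_n) : 'rV[int]_n := \row_i (r 0 i : nat)%:Z.
apply: (@sub_finite_set _ _ (range f)).
  move=> v /= vP.
  have vm i : (`|v 0%R i| < m)%N by have := vP i; lia.
  exists (\row_i Ordinal (vm i)) => //.
  by apply/rowP => i; rewrite /f !mxE /=; have := vP i; lia.
exact/finite_image/finite_finset.
Qed.

Lemma Zn_finitely_generated n : finitely_generated (Zn n).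
Proof.
pose e (i : 'I_n) : Zn n := delta_mx 0 i : 'rV[int]_n.
exists (range e); first exact/finite_image/finite_finset.
apply/seteqP; split=> // v _.
have -> : v = \sum_i (v : 'rV[int]_n) 0 i *: (delta_mx 0 i : 'rV[int]_n).
  exact: row_sum_delta.
elim/big_ind: _ => [|a b|i _].
- exact: generated_subgroup1.
- exact: generated_subgroupM.
have geni : generated_subgroup (range e) (e i).
  by apply: sub_generated_subgroup; exists i.
have natZ k :
    generated_subgroup (range e) (k%:Z *: (delta_mx 0 i : 'rV[int]_n)).
  elim: k => [|k IHk]; first by rewrite scale0r; apply: generated_subgroup1.
  rewrite intS scalerDl scale1r; exact: generated_subgroupM geni IHk.
case: (_ 0 i) => k; first exact: natZ.
by rewrite NegzE scaleNr; apply: (generated_subgroupV (natZ k.+1)).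
Qed.

End IntegerLattice.

(** * The projection to the abelianization and the map to [Zn n] *)

Section AbelianizationMap.
Variable G : groupType.

Lemma ab_piM (x y : G) : ab_pi (x * y)%g = (ab_pi x + ab_pi y)%R.
Proof. by symmetry; apply: ab_addE. Qed.

Lemma ab_piV (x : G) : ab_pi x^-1%g = (- ab_pi x)%R.
Proof. by apply/eqP; rewrite -addr_eq0 -ab_piM mulVg. Qed.

Lemma ab_pi_eq0 (x : G) : ab_pi x = 0%R -> derived_subgroup G x.
Proof.
move=> x0; have /ab_piP/asboolP : ab_pi 1%g = ab_pi x by rewrite x0.
by rewrite invg1 mul1g.
Qed.

Lemma abelianization_span (s : seq G) : generating [set` s] ->
  forall a : abelianization G, exists l,
  a = lincomb (size [seq ab_pi x | x <- s]) (nth 0%R [seq ab_pi x | x <- s]) l.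
Proof.
move=> gens a; rewrite -(ab_pi_repr a).
have : generated_subgroup [set` s] (repr a) by rewrite gens.
elim/generated_subgroup_ind => {a} [|x y [l xl] [l' yl']|x [l xl]|x xs].
- by exists (fun=> 0%R); rewrite lincomb0.
- by exists (fun i => l i + l' i)%R; rewrite lincombD ab_piM -xl -yl'.
- by exists (fun i => - l i)%R; rewrite lincombN ab_piV -xl.
(* The coefficients are a Kronecker delta at the first occurrence of [x] in [s]. *)
- exists (fun i => (i == index x s)%:Z%R).
  have lt_xs : index x s < size [seq ab_pi y | y <- s].
    by rewrite size_map index_mem.
  rewrite /lincomb (bigD1 (Ordinal lt_xs)) //= eqxx big1 => [|i /negbTE ix].
    by rewrite addr0 (nth_map x) ?nth_index // index_mem.
  by move: ix; rewrite -val_eqE /= => ->.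
Qed.

End AbelianizationMap.

Theorem proposition2p37 (R : realType) (G : groupType) (S : set G)
    (finS : finite_set S) (genS : generating S) (conjS : conj_invariant S) :
  exists n : nat,
    has_rank (abelianization G) n /\ quasi_isometric_groups R G (Zn n).
Proof.
have [s Ss] : exists s : seq G, S = [set` s] by apply/finite_seqP.
have gens : generating [set` s] by rewrite -Ss.
have [n [x [m [F [m_gt0 xI structP]]]]] :=
  finitely_generated_structure [seq ab_pi y | y <- s].
have /choice[psi psiE] (a : abelianization G) :
    exists v : 'rV[int]_n, (a *+ m = \sum_(i < n) x i *~ v 0 i)%R.
  have [l ->] := abelianization_span gens a.
  have [[c ->] _] := structP l; exists (\row_i c i)%R.
  by apply: eq_bigr => i _; rewrite mxE.
exists n; split; first exact: has_rank_coordinates m_gt0 xI psi psiE.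
split; [by exists S | exact: Zn_finitely_generated |].
move=> S' T finS' genS' finT genT.
pose phi (g : G) : Zn n := psi (ab_pi g).
have phiM : {morph phi : g h / (g * h)%g}.
  by move=> g h; rewrite /phi ab_piM (coordinatesD xI psiE).
(* [phi] is [psi] after the projection [pi]. The kernel of [pi] is finite by conjugation invariance,
   so the preimage of the finite kernel of [psi] is finite. *)
have finK : finite_set [set g | phi g = 1%g].
  pose pi : G -> Algebra.to_multiplicative (abelianization G) := @ab_pi G.
  have piM : {morph pi : g h / (g * h)%g} by exact: ab_piM.
  have finker : finite_set [set g | pi g = 1%g].
    apply: sub_finite_set (finite_derived_subgroup finS genS conjS) => g.
    exact: ab_pi_eq0.
  apply: (finite_preimage_hom piM finker (B := [set a | psi a = 0%R])).
  apply: (finite_coordinates_kernel m_gt0 xI psiE (F := F)) => a.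
  have [l ->] := abelianization_span gens a.
  by have [_] := structP l.
pose box : set (Zn n) := [set v : 'rV[int]_n | forall i, (0 <= v 0 i < m%:Z)%R].
have coarse h : exists g, box ((phi g)^-1 * h)%g.
  (* Dividing the entries of [h] by [m], the multiple [m c] is a value of [phi] and the remainders
     lie in the box. *)
  pose c i := ((h : 'rV[int]_n) ord0 i %/ m%:Z)%Z.
  exists (repr (\sum_(i < n) x i *~ c i)%R) => i.
  rewrite /phi ab_pi_repr (coordinates_sum xI psiE).
  have -> : ((((\row_j (c j * m%:Z))%R : Zn n)^-1 * h)%g : 'rV[int]_n) 0%R i =
      ((h : 'rV[int]_n) ord0 i %% m%:Z)%Z.
    by rewrite /modz /= !mxE addrC.
  by rewrite modz_ge0 ?ltz_pmod //; lia.
have finbox : finite_set box by exact: finite_box.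
exists phi.
exact: (hom_quasi_isometry phiM finK finS' genS' finT genT finbox coarse R).
Qed.
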